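(* Let $V_H\subset V_h\subset V$ be the coarse and fine spaces, let $(\bar\lambda_h,\bar u_h)$ be an exact eigenpair of the discrete eigenvalue problem on $V_h$, and let $(\lambda_h^{(\ell)},u_h^{(\ell)})\in\mathbb R\times V_h$ ($\ell\ge1$) be the eigenpair approximations produced by the augmented subspace method for one eigenpair, under the standing assumptions described in the context. For $\ell\ge 1$ define the spectral projector $E_h^{(\ell)}:V\to\mathrm{span}\{u_h^{(\ell)}\}$ by $$a(E_h^{(\ell)}w,u_h^{(\ell)})=a(w,u_h^{(\ell)}),\qquad w\in V .$$ Then for every $\ell\ge1$ the eigenpair approximation $(\lambda_h^{(\ell+1)},u_h^{(\ell+1)})$ satisfies $$\|\bar u_h-E_h^{(\ell+1)}\bar u_h\|_a\le\bar\lambda_h\sqrt{1+\frac{\eta_a^2(V_H)}{\lambda_1\delta_\lambda^2}}\Big(1+\frac1{\lambda_1\delta_\lambda}\Big)\eta_a^2(V_H)\,\|\bar u_h-E_h^{(\ell)}\bar u_h\|_a,$$ $$\|\bar u_h-E_h^{(\ell+1)}\bar u_h\|_b\le\Big(1+\frac1{\lambda_1\delta_\lambda}\Big)\eta_a(V_H)\,\|\bar u_h-E_h^{(\ell+1)}\bar u_h\|_a .$$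
   Context: Setting. $V\subset W$ are (infinite-dimensional, real) Hilbert spaces; $a(\cdot,\cdot)$ on $V\times V$ and $b(\cdot,\cdot)$ on $W\times W$ are symmetric positive definite bilinear forms, with $\|v\|_a=\sqrt{a(v,v)}$ the norm of $V$ and $\|w\|_b=\sqrt{b(w,w)}$ the norm of $W$. It is assumed that $\|\cdot\|_a$ is relatively compact with respect to $\|\cdot\|_b$, i.e. every sequence bounded in $\|\cdot\|_a$ has a subsequence that is Cauchy in $\|\cdot\|_b$. The eigenvalue problem is: find $(\lambda,u)\in\mathbb R\times V$ with $a(u,u)=1$ and $a(u,v)=\lambda b(u,v)$ for all $v\in V$. Its eigenvalues, repeated according to multiplicity, are $0<\lambda_1\le\lambda_2\le\cdots\to\infty$. $V_h\subset V$ is a finite-dimensional subspace (e.g. a finite element space). The discrete eigenvalue problem on $V_h$ is: find $(\bar\lambda_h,\bar u_h)\in\mathbb R\times V_h$ with $a(\bar u_h,\bar u_h)=1$ and $a(\bar u_h,v_h)=\bar\lambda_h b(\bar u_h,v_h)$ for all $v_h\in V_h$. The coarse space $V_H$ (e.g. a linear finite element space on a coarse mesh) is a subspace of $V_h$. The operator $T:W\to V$ is defined by $a(Tf,v)=b(f,v)$ for all $v\in V$, and $$\eta_a(V_H)=\sup_{f\in W,\ \|f\|_b=1}\ \inf_{v\in V_H}\|Tf-v\|_a .$$ Augmented subspace method for one eigenpair. An initial function $\widehat u_h^{(1)}\in V_h$ is given. For $\ell\ge1$ let $V_{H,h}^{(\ell)}=V_H+\mathrm{span}\{\widehat u_h^{(\ell)}\}$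 and consider the eigenvalue problem on $V_{H,h}^{(\ell)}$: find $(\lambda^{(\ell)},u^{(\ell)})\in\mathbb R\times V_{H,h}^{(\ell)}$ with $a(u^{(\ell)},u^{(\ell)})=1$ and $a(u^{(\ell)},v)=\lambda^{(\ell)}b(u^{(\ell)},v)$ for all $v\in V_{H,h}^{(\ell)}$. Let its eigenvalues with multiplicity be $\lambda_{1}^{(\ell)}\le\cdots\le\lambda_{N^{(\ell)}}^{(\ell)}$, with $a$-orthonormal eigenfunctions. One of these eigenpairs, with index $i_\ell$, is selected and denoted $(\lambda_h^{(\ell)},u_h^{(\ell)})$ (in the algorithm: the one whose eigenfunction has the largest component in $\mathrm{span}\{\widehat u_h^{(\ell)}\}$). The next function $\widehat u_h^{(\ell+1)}\in V_h$ is the solution of $$a(\widehat u_h^{(\ell+1)},v_h)=\lambda_h^{(\ell)}\,b(u_h^{(\ell)},v_h)\qquad\forall v_h\in V_h,$$ and the process is repeated with $\ell+1$ in place of $\ell$. Standing assumptions. For every $\ell\ge1$ the selected eigenpair is the closest to the exact discrete eigenpair $(\bar\lambda_h,\bar u_h)$, in the sense that $|1/\lambda_{i_\ell}^{(\ell)}-1/\bar\lambda_h|=\min_j|1/\lambda_j^{(\ell)}-1/\bar\lambda_h|$. Moreover the eigenvalue gaps have a uniform lower bound $\delta_\lambda>0$: $$\min_{j\ne i_\ell}\left|\frac1{\lambda_j^{(\ell)}}-\frac1{\bar\lambda_h}\right|\ge\delta_\lambda\qquad\text{for all }\ell\ge1 .$$ *)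

(* Defs.v *)
From HB Require Import structures.
From mathcomp Require Import all_boot all_order all_algebra.
From mathcomp Require Import all_classical all_reals all_analysis.
Set Implicit Arguments.
Unset Strict Implicit.
Unset Printing Implicit Defensive.
Import Order.TTheory GRing.Theory Num.Theory.
Import numFieldNormedType.Exports.
Local Open Scope classical_set_scope.
Local Open Scope ring_scope.

(* {dot U for idfun} is the library type of symmetric positive definite
   bilinear forms on U. *)

Definition enorm (R : realType) (U : lmodType R) (f : {dot U for idfun})
  (u : U) : R := Num.sqrt (f u u).

Section Subspaces.
Context {R : realType} {U : lmodType R}.

Definition linear_subspace (A : set U) : Prop :=
  A 0 /\ forall (c : R) (u v : U), A u -> A v -> A (c *: u + v).

Definition lspan (A : set U) : set U := smallest linear_subspace A.

Definition finite_dim (A : set U) : Prop :=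
  exists s : seq U, A = lspan [set` s].

End Subspaces.

(* The inclusion of V in W is an injective linear map iota : V -> W, so b(u, v)
   for u, v in V reads b (iota u) (iota v). *)
Section AugmentedSubspace.
Context {R : realType} {V W : completeNormedModType R}.
Variables (a : {dot V for idfun}) (b : {dot W for idfun}).
Variable iota : {linear V -> W}.

Definition relatively_compact_norm : Prop :=
  forall u : nat -> V,
    (exists M : R, forall n, enorm a (u n) <= M) ->
    exists2 phi : nat -> nat, increasing_seq phi &
      forall eps : R, 0 < eps -> exists n0 : nat, forall m n : nat,
        (n0 <= m)%N -> (n0 <= n)%N ->
        enorm b (iota (u (phi m)) - iota (u (phi n))) < eps.

Definition eigenpair (U : set V) (mu : R) (u : V) : Prop :=
  [/\ U u, a u u = 1 & forall v, U v -> a u v = mu * b (iota u) (iota v)].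

(* (mu i), i in I, lists the eigenvalues of the problem on U repeated according
   to multiplicity: the a-orthonormal eigenfunctions e i with mu i = nu form a
   basis of the eigenspace of nu. *)
Definition eigensystem (U : set V) (I : Type) (mu : I -> R) (e : I -> V)
    : Prop :=
  [/\ forall i, eigenpair U (mu i) (e i),
      forall i j, i <> j -> a (e i) (e j) = 0 &
      forall nu u, eigenpair U nu u -> lspan (e @` [set i | mu i = nu]) u].

(* Indices start at 0: lambda_1 is lam 0. *)
Definition eigenvalue_sequence (lam : nat -> R) : Prop :=
  [/\ 0 < lam 0%N, nondecreasing_seq lam, lam n @[n --> \oo] --> +oo &
      exists e : nat -> V, eigensystem setT lam e].

Definition solution_operator (T : W -> V) : Prop :=
  forall f v, a (T f) v = b f (iota v).

Definition eta_a (T : W -> V) (VH : set V) : R :=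
  sup [set inf [set enorm a (T f - v) | v in VH]
        | f in [set f : W | enorm b f = 1]].

Definition augmented_space (VH : set V) (uhat : V) : set V :=
  [set v + w | v in VH & w in lspan [set uhat]].

(* Meaningful for l >= 1 only; entries at l = 0 are unconstrained.  The problem
   on the l-th augmented space has the N l eigenpairs (mu l j, e l j), and the
   one with index i l is selected. *)
Definition augmented_subspace_method (Vh VH : set V) (uhat : nat -> V)
    (N : nat -> nat) (mu : forall l, 'I_(N l) -> R)
    (e : forall l, 'I_(N l) -> V) (i : forall l, 'I_(N l)) : Prop :=
  Vh (uhat 1%N) /\
  forall l : nat, (1 <= l)%N ->
    [/\ eigensystem (augmented_space VH (uhat l)) (mu l) (e l),
        {homo mu l : j k / (j <= k)%N >-> j <= k},
        Vh (uhat l.+1) &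
        forall v, Vh v ->
          a (uhat l.+1) v = mu l (i l) * b (iota (e l (i l))) (iota v)].

Definition spectral_projector (u : V) (E : V -> V) : Prop :=
  forall w, lspan [set u] (E w) /\ a (E w) u = a w u.

End AugmentedSubspace.

(* Main.v *)
Require Import Defs.
From HB Require Import structures.
From mathcomp Require Import all_boot all_order all_algebra.
From mathcomp Require Import all_classical all_reals all_analysis.
From mathcomp Require Import ring lra.
Set Implicit Arguments.
Unset Strict Implicit.
Unset Printing Implicit Defensive.
Import Order.TTheory GRing.Theory Num.Theory.
Import numFieldNormedType.Exports.
Local Open Scope classical_set_scope.
Local Open Scope ring_scope.

(** Why the theorem holds.  Let A be an augmented space with a-orthonormal
    eigenfunctions e_j and eigenvalues mu_j, let P be the a-orthogonal
    projection onto A, and put r = ubar - P ubar and D = P ubar - E ubar.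
    Since ubar is an eigenfunction on Vh, which contains A, testing both
    eigenvalue problems gives
      (1/mu_j - 1/lbar) a(ubar, e_j) = - b(r, e_j)      (eigenvalue_defect).
    Off the selected index the left factor is at least delta in absolute value,
    and the sqrt(mu_j) e_j are b-orthonormal, so Bessel's inequality bounds
    ||D||_a by ||r||_b / (sqrt(lam_1) delta)                  (gap_estimate).
    The Aubin-Nitsche duality argument gives ||r||_b <= eta ||r||_a
    (aubin_nitsche).  As r and D are a-orthogonal, ubar - E ubar = r + D is
    controlled in the energy norm by ||r||_a (eigenfunction_estimate_a) and in
    the b norm by its own energy norm (eigenfunction_estimate_b).

    The gain between two steps comes from the correction problem.  If
    E^(l) ubar = k u^(l), then ubar minus a suitable multiple of uhat^(l+1) is
    the Vh-projection of lbar T (ubar - E^(l) ubar).  The next space contains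
    both uhat^(l+1) and VH, so its projection error is at most
    lbar eta ||ubar - E^(l) ubar||_b (correction_estimate), and the b norm
    estimate at step l supplies the second factor eta.

    Two spectral facts are used in this argument: b(v, v) <= a(v, v) / lam_1 on
    V (rayleigh_le_first_eigenvalue), and the e_j span A (eigensystem_complete).
    Both follow from rayleigh_maximizer: on a closed subspace that is not zero
    the quotient b(v, v) / a(v, v) attains its maximum, at an eigenfunction.
    Applied to V, the maximum is the inverse of a listed eigenvalue, hence at
    most 1 / lam_1.  Applied to the a-orthogonal complement of the e_j in A, it
    would produce an eigenfunction of A outside the given system, so this
    complement is zero. *)

(** * Symmetric positive definite forms *)

(** The form of Cauchy-Schwarz that also serves semidefinite forms: with p = 0
    it says that a vector on which such a form vanishes lies in its radical. *)
Lemma nneg_quadratic_discr (R : realType) (p q r : R) : 0 <= r ->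
  (forall t, 0 <= p + 2 * t * q + t ^+ 2 * r) -> q ^+ 2 <= p * r.
Proof.
move=> r0 h; have [r_eq0|rn0] := eqVneq r 0.
  have [->|qn0] := eqVneq q 0; first by rewrite r_eq0 mulr0 expr0n.
  (* At this t the affine function p + 2 t q takes the value -1. *)
  have := h (- (p + 1) / (2 * q)).
  rewrite r_eq0 mulr0 addr0 -mulrA.
  have -> : - (p + 1) / (2 * q) * q = - (p + 1) / 2 by field.
  by rewrite mulrC divfK ?pnatr_eq0//; lra.
have rgt0 : 0 < r by rewrite lt_def rn0.
(* The minimum of the quadratic is at t = - q / r. *)
have := h (- q / r).
have -> : p + 2 * (- q / r) * q + (- q / r) ^+ 2 * r = p - q ^+ 2 / r by field.
by rewrite subr_ge0 ler_pdivrMr.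
Qed.

Section DotForm.
Context {R : realType} {U : lmodType R} (f : {dot U for idfun}).

Lemma dotC u v : f u v = f v u.
Proof. by rewrite hermC expr0 mul1r. Qed.

Lemma dotDl u v w : f (u + v) w = f u w + f v w.
Proof. by rewrite linearDl. Qed.
Lemma dotDr u v w : f w (u + v) = f w u + f w v.
Proof. by rewrite linearDr. Qed.
Lemma dotBl u v w : f (u - v) w = f u w - f v w.
Proof. by rewrite linearBl. Qed.
Lemma dotBr u v w : f w (u - v) = f w u - f w v.
Proof. by rewrite linearBr. Qed.
Lemma dotZl c u v : f (c *: u) v = c * f u v.
Proof. by rewrite linearZl_LR. Qed.
Lemma dotZr c u v : f u (c *: v) = c * f u v.
Proof. by rewrite dotC dotZl dotC. Qed.
Lemma dot0l v : f 0 v = 0.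
Proof. by rewrite linear0l. Qed.
Lemma dot_suml I (r : seq I) (P : pred I) (F : I -> U) v :
  f (\sum_(i <- r | P i) F i) v = \sum_(i <- r | P i) f (F i) v.
Proof. by rewrite linear_sumlz. Qed.

Lemma dot_gt0 u : u != 0 -> 0 < f u u.
Proof. exact: neq0_dnorm_gt0. Qed.
Lemma dot_ge0 u : 0 <= f u u.
Proof. by have [->|/dot_gt0/ltW//] := eqVneq u 0; rewrite dot0l. Qed.
Lemma dot_eq0 u : f u u = 0 -> u = 0.
Proof. by have [//|/dot_gt0 + h] := eqVneq u 0; rewrite h ltxx. Qed.

Lemma enorm_ge0 u : 0 <= enorm f u.
Proof. exact: sqrtr_ge0. Qed.
Lemma sqr_enorm u : enorm f u ^+ 2 = f u u.
Proof. by rewrite sqr_sqrtr// dot_ge0. Qed.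
Lemma enorm0 : enorm f 0 = 0.
Proof. by rewrite /enorm dot0l sqrtr0. Qed.
Lemma enormZ c u : enorm f (c *: u) = `|c| * enorm f u.
Proof. by rewrite /enorm dotZl dotZr mulrA -expr2 sqrtrM ?sqr_ge0// sqrtr_sqr. Qed.
Lemma enorm_eq0 u : enorm f u = 0 -> u = 0.
Proof. by move=> h; apply: dot_eq0; rewrite -sqr_enorm h expr0n. Qed.
Lemma dot_normalize u : u != 0 -> f ((enorm f u)^-1 *: u) ((enorm f u)^-1 *: u) = 1.
Proof.
move=> u0; have e0 : enorm f u != 0 by apply: contra_neq u0 => /enorm_eq0.
by rewrite dotZl dotZr -sqr_enorm expr2 mulKf// mulVf.
Qed.

Lemma enorm_le u x : 0 <= x -> f u u <= x ^+ 2 -> enorm f u <= x.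
Proof. by move=> x0; rewrite -sqr_enorm ler_sqr// nnegrE ?enorm_ge0. Qed.

Lemma dot_CauchySchwarz u v : `|f u v| <= enorm f u * enorm f v.
Proof.
have uv0 : 0 <= enorm f u * enorm f v by rewrite mulr_ge0 ?enorm_ge0.
rewrite -ler_sqr ?nnegrE// exprMn !sqr_enorm real_normK ?num_real//.
apply: nneg_quadratic_discr (dot_ge0 v) _ => t.
have := dot_ge0 (u + t *: v).
by rewrite dotDl !dotDr !dotZl !dotZr (dotC v u); congr (0 <= _); ring.
Qed.

Lemma enormD u v : enorm f (u + v) <= enorm f u + enorm f v.
Proof.
apply: enorm_le; first by rewrite addr_ge0 ?enorm_ge0.
rewrite dotDl !dotDr (dotC v u) sqrrD !sqr_enorm.
have := le_trans (ler_norm _) (dot_CauchySchwarz u v); lra.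
Qed.
End DotForm.

(** * Orthonormal families and their projections *)

Section Orthogonal.
Context {R : realType} {U : lmodType R} (f : {dot U for idfun}).
Context {n : nat}.
Implicit Types e : 'I_n -> U.

Lemma dot_sum_orthogonal e (d c : 'I_n -> R) (P : pred 'I_n) :
  (forall i j, f (e i) (e j) = (i == j)%:R * d i) ->
  f (\sum_(i | P i) c i *: e i) (\sum_(i | P i) c i *: e i)
    = \sum_(i | P i) c i ^+ 2 * d i.
Proof.
move=> he; rewrite dot_suml; apply: eq_bigr => i Pi.
rewrite dotZl dotC dot_suml (bigD1 i)//= big1 => [|j /andP[_ ji]].
  by rewrite addr0 dotZl he eqxx mul1r; ring.
by rewrite dotZl he (negbTE ji) mul0r mulr0.
Qed.

Definition orthonormal_family e := forall i j, f (e i) (e j) = (i == j)%:R.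

Definition oproj e v := \sum_i f v (e i) *: e i.

Context {e : 'I_n -> U}.
Hypothesis he : orthonormal_family e.

Let he1 i j : f (e i) (e j) = (i == j)%:R * 1.
Proof. by rewrite mulr1. Qed.

Lemma dot_oproj v i : f (oproj e v) (e i) = f v (e i).
Proof.
rewrite dot_suml (bigD1 i)//= big1 => [|j ji].
  by rewrite dotZl he eqxx mulr1 addr0.
by rewrite dotZl he (negbTE ji) mulr0.
Qed.

Lemma oprojB u v : oproj e (u - v) = oproj e u - oproj e v.
Proof. by rewrite -sumrB; apply: eq_bigr => i _; rewrite dotBl scalerBl. Qed.

Lemma oproj_orthogonal v w : f (v - oproj e v) (oproj e w) = 0.
Proof.
rewrite dotC dot_suml big1// => i _.
by rewrite dotZl (dotC _ (e i)) dotBl dot_oproj subrr mulr0.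
Qed.

(** Pythagoras for v - proj w = (v - proj v) + proj (v - w).  It yields the
    minimality of the projection, and Bessel's inequality at w = 0. *)
Lemma pythagoras_oproj v w :
  f (v - oproj e w) (v - oproj e w)
    = f (v - oproj e v) (v - oproj e v) + f (oproj e (v - w)) (oproj e (v - w)).
Proof.
have -> : v - oproj e w = (v - oproj e v) + oproj e (v - w).
  by rewrite oprojB addrA subrK.
exact/hnormDd/oproj_orthogonal.
Qed.

Lemma oproj_min v w : enorm f (v - oproj e v) <= enorm f (v - oproj e w).
Proof.
apply: enorm_le; first exact: enorm_ge0.
by rewrite sqr_enorm (pythagoras_oproj v w) lerDl dot_ge0.
Qed.

Lemma bessel v : \sum_i f v (e i) ^+ 2 <= f v v.
Proof.
have := pythagoras_oproj v 0.
rewrite subr0 {1 2}/oproj big1 => [|i _]; last by rewrite dot0l scale0r.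
rewrite subr0 => ->.
rewrite /oproj [X in _ <= _ + X](dot_sum_orthogonal _ _ he1).
under [X in _ <= _ + X]eq_bigr do rewrite mulr1.
by rewrite lerDr dot_ge0.
Qed.

End Orthogonal.

(** * Finite-dimensional subspaces *)

Lemma lspan_coord (R : realType) (U : lmodType R) (s : seq U) v :
  lspan [set` s] v -> exists c : 'I_(size s) -> R, v = \sum_i c i *: s`_i.
Proof.
apply: (_ : _ `<=` [set x | exists c, x = _]).
apply: smallest_sub; first split.
- by exists (fun=> 0); rewrite big1// => i _; rewrite scale0r.
- move=> k _ _ [c ->] [d ->]; exists (fun i => k * c i + d i).
  rewrite scaler_sumr -big_split/=; apply: eq_bigr => i _.
  by rewrite scalerA scalerDl.
- move=> x /= xs; have ix : (index x s < size s)%N by rewrite index_mem.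
  exists (fun j => (j == Ordinal ix)%:R).
  rewrite (bigD1 (Ordinal ix))//= eqxx scale1r nth_index// big1 ?addr0// => j.
  by move=> /negbTE ->; rewrite scale0r.
Qed.

Lemma lspan1 (R : realType) (U : lmodType R) (u v : U) :
  lspan [set u] v -> exists c : R, v = c *: u.
Proof.
apply: (_ : _ `<=` [set x | exists c, x = c *: u]).
apply: smallest_sub; first split.
- by exists 0; rewrite scale0r.
- by move=> k _ _ [c ->] [d ->]; exists (k * c + d); rewrite scalerDl scalerA.
- by move=> x ->; exists 1; rewrite scale1r.
Qed.

Section Subspace.
Context {R : realType} {U : lmodType R} {A : set U}.
Hypothesis hA : linear_subspace A.

Lemma subspaceZ c u : A u -> A (c *: u).
Proof. by case: hA => A0 AD Au; rewrite -[_ *: _]addr0; apply: AD. Qed.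
Lemma subspaceD u v : A u -> A v -> A (u + v).
Proof. by case: hA => _ AD Au Av; rewrite -[u]scale1r; apply: AD. Qed.
Lemma subspaceB u v : A u -> A v -> A (u - v).
Proof. by move=> Au Av; rewrite -scaleN1r; apply/subspaceD/subspaceZ. Qed.
Lemma subspace_sum n (P : pred 'I_n) (F : 'I_n -> U) :
  (forall i, P i -> A (F i)) -> A (\sum_(i | P i) F i).
Proof.
by move=> h; apply: (big_ind A) => //; [case: hA|exact: subspaceD].
Qed.
Lemma subspace_oproj (f : {dot U for idfun}) n (e : 'I_n -> U) v :
  (forall i, A (e i)) -> A (oproj f e v).
Proof. by move=> Ae; apply: subspace_sum => i _; apply: subspaceZ. Qed.
End Subspace.

Lemma lspan_subspace (R : realType) (U : lmodType R) (X : set U) :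
  linear_subspace (lspan X).
Proof.
split=> [A [[A0 _] _]//|c u v hu hv A AX].
by case: (AX) => -[_ AD] _; apply: AD; [exact: hu|exact: hv].
Qed.

Lemma mem_lspan1 (R : realType) (U : lmodType R) (u : U) c :
  lspan [set u] (c *: u).
Proof. by apply: (subspaceZ (lspan_subspace _)) => A [_]; apply. Qed.

Lemma lspan_orthogonal (R : realType) (U : lmodType R) (f : {dot U for idfun})
    (X : set U) u v :
  lspan X u -> (forall x, X x -> f x v = 0) -> f u v = 0.
Proof.
move=> Xu Xv; apply: (Xu [set x | f x v = 0]); split=> //.
by split=> [|c x y /= xv yv] /=; rewrite ?dot0l// dotDl dotZl xv yv mulr0 addr0.
Qed.

Section OrthonormalBasis.
Context {R : realType} {U : lmodType R} (f : {dot U for idfun}).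

(** If C holds the coordinates of q in s and G the products f (s_k, q_j), then
    C G is the Gram matrix of q, the identity, so n cannot exceed size s. *)
Lemma orthonormal_size n (q : 'I_n -> U) (s : seq U) :
  orthonormal_family f q -> (forall i, lspan [set` s] (q i)) -> (n <= size s)%N.
Proof.
move=> hq qs; have [c hc] := choice (fun i => lspan_coord (qs i)).
pose C := \matrix_(i < n, k < size s) c i k.
pose G := \matrix_(k < size s, j < n) f s`_k (q j).
apply: (@mulmx1_min _ _ _ C G); apply/matrixP => i j; rewrite !mxE -hq [q i]hc.
by rewrite dot_suml; apply: eq_bigr => k _; rewrite !mxE dotZl.
Qed.

Lemma orthonormal_extend n (q : 'I_n -> U) w :
  orthonormal_family f q -> f w w = 1 -> (forall i, f w (q i) = 0) ->
  orthonormal_family f (fun i : 'I_n.+1 => oapp q w (unlift ord_max i)).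
Proof.
move=> hq w1 wq i j; case: unliftP => [i'|] ->; case: unliftP => [j'|] -> /=.
- by rewrite (inj_eq lift_inj).
- by rewrite dotC wq eq_sym (negbTE (neq_lift _ _)).
- by rewrite wq (negbTE (neq_lift _ _)).
- by rewrite eqxx.
Qed.

(** An orthonormal family in A of maximal length exists because its length is
    bounded by the number of generators of B; it spans A, since otherwise the
    normalized residual of a projection would extend it. *)
Lemma orthonormal_basis (A B : set U) :
  linear_subspace A -> finite_dim B -> A `<=` B ->
  exists n (q : 'I_n -> U), [/\ orthonormal_family f q,
    forall i, A (q i) & forall v, A v -> v = oproj f q v].
Proof.
move=> hA [s Bs] AB.
pose P n := `[< exists q : 'I_n -> U,
  orthonormal_family f q /\ forall i, A (q i) >].
have P0 : exists n, P n.
  by exists 0%N; apply/asboolP; exists (fun=> 0); split; case.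
have Ps n : P n -> (n <= size s)%N.
  move=> /asboolP[q [hq Aq]]; apply: orthonormal_size hq _ => i.
  by rewrite -Bs; apply/AB/Aq.
case: (ex_maxnP P0 Ps) => n /asboolP[q [hq Aq]] nmax; exists n, q; split=> // v Av.
apply/eqP; rewrite -subr_eq0; apply/negPn/negP => wn0.
set w := v - oproj f q v in wn0.
have Aw : A w by apply: subspaceB => //; exact: subspace_oproj.
suff: (n.+1 <= n)%N by rewrite ltnn.
apply: nmax; apply/asboolP.
exists (fun i : 'I_n.+1 => oapp q ((enorm f w)^-1 *: w) (unlift ord_max i)).
split=> [|i]; last by case: (unlift _ _) => //=; exact: subspaceZ.
apply: orthonormal_extend => // [|i]; first exact: dot_normalize.
by rewrite dotZl dotBl dot_oproj// subrr mulr0.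
Qed.
End OrthonormalBasis.

(** The distance from a limit point x to its projection is at most its distance
    to any point of the span, by minimality of the projection. *)
Lemma orthonormal_span_closed (R : realType) (V : completeNormedModType R)
    (a : {dot V for idfun}) n (q : 'I_n -> V) :
  (forall v : V, `|v| = enorm a v) -> orthonormal_family a q ->
  closed [set v | v = oproj a q v].
Proof.
move=> ha hq x clx /=; apply/eqP; rewrite -subr_eq0; apply/eqP/(@enorm_eq0 _ _ a).
apply/eqP; rewrite eq_le enorm_ge0 andbT.
suff small (eps : R) : 0 < eps -> enorm a (x - oproj a q x) <= eps.
  by apply/ler_addgt0Pr => eps eps0; rewrite add0r small.
move=> eps0; have [y [/= yq]] := clx _ (nbhsx_ballx x eps eps0).
rewrite -ball_normE/= ha yq => /ltW; apply: le_trans; exact: oproj_min.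
Qed.

(** * Maximizing the Rayleigh quotient *)

Lemma increasing_seq_ge (phi : nat -> nat) :
  increasing_seq phi -> forall n, (n <= phi n)%N.
Proof.
move=> hphi; elim=> // n IHn; apply: leq_ltn_trans IHn _.
by rewrite ltnNge -leEnat hphi -ltnNge.
Qed.

Section Rayleigh.
Context {R : realType} {V W : completeNormedModType R}.
Context {a : {dot V for idfun}} {b : {dot W for idfun}} {iota : {linear V -> W}}.
Hypothesis ha : forall v : V, `|v| = enorm a v.
Hypothesis hcompact : relatively_compact_norm a b iota.

Local Notation B u v := (b (iota u) (iota v)).

(** If the ratio were unbounded, a sequence of a-unit vectors u_n with
    b(u_n, u_n) > n would have no subsequence bounded in the b norm. *)
Lemma compact_norm_bounded :
  has_ubound [set B v v | v in [set v | a v v = 1]].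
Proof.
apply: contrapT => nub.
have big (n : nat) : exists v, a v v = 1 /\ n%:R < B v v.
  apply: contrapT => hn; apply: nub; exists n%:R => _ [v v1 <-].
  by rewrite leNgt; apply/negP => hv; apply: hn; exists v.
have [u hu] := choice big.
have [|phi hphi /(_ 1 ltr01)[n0 hn0]] := @hcompact u.
  by exists 1 => n; rewrite /enorm (hu n).1 sqrtr1.
set K := enorm b (iota (u (phi n0))) + 1.
have K0 : 0 <= K by rewrite addr_ge0 ?enorm_ge0.
pose m := maxn n0 (Num.trunc (K ^+ 2)).+1.
have : K ^+ 2 < B (u (phi m)) (u (phi m)).
  apply: lt_trans (hu _).2; apply: lt_le_trans (truncnS_gt _) _.
  by rewrite ler_nat (leq_trans _ (increasing_seq_ge hphi _))// leq_maxr.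
rewrite -sqr_enorm ltr_sqr ?nnegrE ?enorm_ge0// ltNge => /negP; apply.
rewrite -[iota (u (phi m))](subrKC (iota (u (phi n0)))).
apply: le_trans (enormD _ _ _) _; rewrite lerD2l ltW// hn0//.
by rewrite leq_maxl.
Qed.

(** When s is the supremum of b(v, v) / a(v, v) on a subspace, this quadratic
    form is nonnegative there, and its nonzero zeros are the maximizers; working
    with it instead of the quotient keeps everything quadratic in v. *)
Definition rayleigh_defect (s : R) v := s * a v v - B v v.

Section Defect.
Variable s : R.

Local Notation q := (rayleigh_defect s).

Lemma rayleigh_defect_parallelogram u v :
  q (u + v) + q (u - v) = 2 * (q u + q v).
Proof.
rewrite /rayleigh_defect (linearD iota) (linearB iota).
rewrite !(dotBl, dotDl) !(dotBr, dotDr).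
rewrite (dotC a v u) (dotC b (iota v) (iota u)); ring.
Qed.

Lemma rayleigh_defectZ c v : q (c *: v) = c ^+ 2 * q v.
Proof. by rewrite /rayleigh_defect (linearZ_LR iota) !dotZl !dotZr; ring. Qed.

(** A zero of a nonnegative quadratic form lies in the radical of its polar
    form; here that is the eigenvalue equation. *)
Lemma rayleigh_maximizer_eigenpair (A : set V) u :
  linear_subspace A -> 0 < s -> (forall v, A v -> 0 <= q v) ->
  A u -> a u u = 1 -> q u = 0 -> eigenpair a b iota A s^-1 u.
Proof.
move=> hA s0 qA Au u1 qu; split=> // v Av.
suff: s * a u v - B u v = 0.
  by move/subr0_eq => <-; rewrite mulKf// gt_eqF.
apply/eqP; rewrite -sqrf_eq0 eq_le sqr_ge0 andbT -[leRHS](mul0r (q v)).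
apply: nneg_quadratic_discr (qA _ Av) _ => t.
have : 0 <= q (u + t *: v) by apply: qA; apply/subspaceD/subspaceZ.
rewrite /rayleigh_defect (linearD iota) (linearZ_LR iota).
rewrite !dotDl !dotDr !dotZl !dotZr.
rewrite (dotC a v u) (dotC b (iota v) (iota u)).
move: qu; rewrite /rayleigh_defect => qu; congr (0 <= _).
by rewrite -[X in _ = X + _ + _]qu; ring.
Qed.
End Defect.

Section Maximizer.
Variable A : set V.
Hypotheses (hA : linear_subspace A) (Acl : closed A).
Hypothesis A_neq0 : exists2 v, A v & iota v != 0.

Let X := [set B v v | v in [set v | A v /\ a v v = 1]].
Let s := sup X.
Local Notation q := (rayleigh_defect s).

Let hasX : has_sup X.
Proof.
case: A_neq0 => v Av iv0; have v0 : v != 0.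
  by apply: contraNneq iv0 => ->; rewrite linear0.
split.
  exists (B ((enorm a v)^-1 *: v) ((enorm a v)^-1 *: v)).
  exists ((enorm a v)^-1 *: v) => //.
  by split; [exact: subspaceZ|exact: dot_normalize].
have [M hM] := compact_norm_bounded; exists M => _ [u [_ u1] <-].
by apply: hM; exists u.
Qed.

Let q_ge0 v : A v -> 0 <= q v.
Proof.
move=> Av; have [->|v0] := eqVneq v 0.
  by rewrite /rayleigh_defect (linear0 iota) !dot0l mulr0 subr0.
have : 0 <= q ((enorm a v)^-1 *: v).
  rewrite /rayleigh_defect dot_normalize// mulr1 subr_ge0.
  apply: sup_upper_bound hasX _ _; exists ((enorm a v)^-1 *: v) => //.
  by split; [exact: subspaceZ|exact: dot_normalize].
rewrite rayleigh_defectZ pmulr_rge0// exprn_gt0// invr_gt0 lt_def enorm_ge0 andbT.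
by apply: contra_neq v0 => /enorm_eq0.
Qed.

Let s_gt0 : 0 < s.
Proof.
case: A_neq0 => v Av /(dot_gt0 b) iv0.
have sv : 0 < s * a v v.
  by apply: lt_le_trans iv0 _; rewrite -subr_ge0; exact: q_ge0.
rewrite ltNge; apply/negP => s0; move: sv; rewrite ltNge => /negP; apply.
by rewrite mulr_le0_ge0 ?dot_ge0.
Qed.

(** Compactness gives the Cauchy property in the b norm only. *)
Let maximizing_sequence : exists w : nat -> V,
  [/\ forall n, A (w n) /\ a (w n) (w n) = 1,
    forall n, q (w n) <= n.+1%:R^-1 &
    forall eps : R, 0 < eps -> exists n0 : nat, forall m n : nat,
        (n0 <= m)%N -> (n0 <= n)%N ->
        enorm b (iota (w m) - iota (w n)) < eps].
Proof.
have near_max (n : nat) : exists v, (A v /\ a v v = 1) /\ q v <= n.+1%:R^-1.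
  have n0 : 0 < n.+1%:R^-1 :> R by rewrite invr_gt0 ltr0n.
  have [_ [v [Av v1] <-] hv] := sup_adherent n0 hasX.
  by exists v; split=> //; rewrite /rayleigh_defect v1 mulr1 lerBlDl -lerBlDr ltW.
have [u hu] := choice near_max.
have [|phi hphi hcau] := @hcompact u.
  by exists 1 => n; rewrite /enorm (hu n).1.2 sqrtr1.
exists (u \o phi); split=> [n|n|//]; first exact: (hu _).1.
apply: le_trans (hu _).2 _; rewrite lef_pV2 ?posrE ?ltr0n// ler_nat ltnS.
exact: increasing_seq_ge.
Qed.

(** The b-Cauchy property upgrades to the norm of V: by the parallelogram law
    q (w_m - w_n) <= 2 (q w_m + q w_n) tends to 0, and
    s a(v, v) = q v + b(v, v) for v = w_m - w_n. *)
Let maximizing_sequence_cvg (w : nat -> V) :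
  (forall n, A (w n)) -> (forall n, q (w n) <= n.+1%:R^-1) ->
  (forall eps : R, 0 < eps -> exists n0 : nat, forall m n : nat,
        (n0 <= m)%N -> (n0 <= n)%N ->
        enorm b (iota (w m) - iota (w n)) < eps) ->
  cvgn w.
Proof.
move=> Aw qw hcau; apply: cauchy_cvg; apply: cauchy_exP => eps eps0.
(* s eps^2 must bound s a(w_k - w_n, w_k - w_n): half of it is left to
   b(w_k - w_n, w_k - w_n), and a quarter to each of 2 q w_k and 2 q w_n. *)
pose eta := Num.sqrt (s * eps ^+ 2 / 2).
have eta2 : eta ^+ 2 = s * eps ^+ 2 / 2.
  by rewrite sqr_sqrtr// divr_ge0// mulr_ge0 ?sqr_ge0// ltW.
have se0 : 0 < s * eps ^+ 2 / 2 by rewrite divr_gt0// mulr_gt0// exprn_gt0.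
have [n0 hn0] := hcau eta (etrans (sqrtr_gt0 _) se0).
pose k := maxn n0 (Num.trunc (8 / (s * eps ^+ 2))).
exists (w k); exists k => // n /= kn.
rewrite -ball_normE/= ha.
have qk j : (k <= j)%N -> q (w j) < s * eps ^+ 2 / 8.
  move=> kj; apply: le_lt_trans (qw j) _.
  rewrite -[ltRHS]invrK ltf_pV2 ?posrE ?ltr0n//; last first.
    by rewrite invr_gt0 divr_gt0// mulr_gt0// exprn_gt0.
  rewrite invf_div; apply: lt_le_trans (truncnS_gt _) _.
  by rewrite ler_nat ltnS (leq_trans (leq_maxr _ _) kj).
have := rayleigh_defect_parallelogram s (w k) (w n).
have := q_ge0 (subspaceD hA (Aw k) (Aw n)).
have := qk _ (leqnn k); have := qk _ kn.
have kn0 : (n0 <= k)%N by exact: leq_maxl.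
have hb : B (w k - w n) (w k - w n) < s * eps ^+ 2 / 2.
  rewrite -eta2 (linearB iota) -sqr_enorm ltr_sqr ?nnegrE ?enorm_ge0 ?sqrtr_ge0//.
  exact: hn0 (leq_trans kn0 kn).
move=> q1 q2 q3 h4.
rewrite -ltr_sqr ?nnegrE ?enorm_ge0 ?(ltW eps0)// sqr_enorm.
rewrite -(ltr_pM2l s_gt0).
by move: h4 hb; rewrite [rayleigh_defect s (_ - _)]/rayleigh_defect; lra.
Qed.

(** The limit u of the maximizing sequence has unit norm, and
    q u <= 2 (q (u - w_n) + q w_n) shows that q u = 0. *)
Lemma rayleigh_maximizer : exists s u, [/\ 0 < s, eigenpair a b iota A s^-1 u &
  forall v, A v -> B v v <= s * a v v].
Proof.
have [w [hw qw hcau]] := maximizing_sequence.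
have /cvg_ex[u wu] : cvgn w.
  by apply: maximizing_sequence_cvg => // n; exact: (hw n).1.
have Au : A u.
  by apply: closed_cvg Acl _ _ wu; apply: nearW => n; exact: (hw n).1.
have u1 : a u u = 1.
  have : `|w n| @[n --> \oo] --> `|u| by exact: cvg_norm.
  under eq_fun do rewrite ha /enorm (hw _).2 sqrtr1.
  move=> /(cvg_lim (@Rhausdorff R)); rewrite lim_cst// ha -sqr_enorm => <-.
  by rewrite expr1n.
exists s, u; split=> //; last by move=> v Av; rewrite -subr_ge0; exact: q_ge0.
apply: rayleigh_maximizer_eigenpair => //.
suff small_q (eps : R) : 0 < eps -> q u <= eps.
  apply/eqP; rewrite eq_le q_ge0// andbT; apply/ler_addgt0Pr => eps eps0.
  by rewrite add0r small_q.
move=> eps0.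
have [n] : exists n, n.+1%:R^-1 <= eps / 4 /\ s * a (u - w n) (u - w n) <= eps / 4.
  have eps4 : 0 < eps / 4 by rewrite divr_gt0.
  have seps : 0 < eps / 4 / s by rewrite divr_gt0.
  have small := near_infty_natSinv_lt (PosNum eps4).
  have close : \forall n \near \oo, `|u - w n| < Num.sqrt (eps / 4 / s).
    by move/cvgrPdist_lt : wu; apply; rewrite sqrtr_gt0.
  have [n [/ltW h1]] := filter_ex (filterI small close).
  rewrite ha => h2; exists n; split=> //.
  rewrite -ler_pdivlMl// mulrC -sqr_enorm -(sqr_sqrtr (ltW seps)).
  by rewrite ler_sqr ?nnegrE ?enorm_ge0 ?sqrtr_ge0// ltW.
move=> [h1 h2].
have := rayleigh_defect_parallelogram s (u - w n) (w n).
rewrite subrK.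
have := q_ge0 (subspaceB hA (subspaceB hA Au (hw n).1) (hw n).1).
have : q (u - w n) <= s * a (u - w n) (u - w n).
  by rewrite lerBlDr lerDl dot_ge0.
have := le_trans (qw n) h1; move: h2; lra.
Qed.
End Maximizer.

End Rayleigh.

(** * Spectral consequences *)

Section Eigen.
Context {R : realType} {V W : completeNormedModType R}.
Context {a : {dot V for idfun}} {b : {dot W for idfun}} {iota : {linear V -> W}}.

Local Notation B u v := (b (iota u) (iota v)).

Lemma eigenpair_gt0 A nu u :
  eigenpair a b iota A nu u -> 0 < nu /\ B u u = nu^-1.
Proof.
move=> [Au u1 /(_ u Au)]; rewrite u1 => h.
have nu0 : nu != 0.
  by apply/eqP => n0; move: h; rewrite n0 mul0r => /eqP; rewrite oner_eq0.
have hB : B u u = nu^-1 by rewrite -[LHS](mulKf nu0) -h mulr1.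
split=> //; have := dot_ge0 b (iota u); rewrite hB invr_ge0 le0r.
by rewrite (negbTE nu0).
Qed.

(** This is how the completeness clause of an eigensystem enters the proofs: an
    eigenfunction that avoids the listed ones is a contradiction. *)
Lemma eigenpair_not_orthogonal A (I : Type) (mu : I -> R) e nu u :
  eigensystem a b iota A mu e -> eigenpair a b iota A nu u ->
  ~ forall i, mu i = nu -> a (e i) u = 0.
Proof.
move=> [_ _ span] hu eu; have [_ u1 _] := hu.
have : a u u = 0.
  by apply: lspan_orthogonal (span _ _ hu) _ => _ [i /= iq <-]; exact: eu.
by rewrite u1 => /eqP; rewrite oner_eq0.
Qed.

Hypothesis ha : forall v : V, `|v| = enorm a v.
Hypothesis hcompact : relatively_compact_norm a b iota.
Hypothesis iota_inj : injective iota.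

Let iota_neq0 v : v != 0 -> iota v != 0.
Proof. by apply: contra_neq => v0; apply: iota_inj; rewrite v0 linear0. Qed.

(** The maximum of b(v, v) / a(v, v) over V is the inverse of an eigenvalue,
    which occurs in the list and is therefore at least its first entry. *)
Lemma rayleigh_le_first_eigenvalue (lam : nat -> R) :
  eigenvalue_sequence a b iota lam ->
  forall v, B v v <= (lam 0%N)^-1 * a v v.
Proof.
move=> [lam0 lam_mono _ [e he]] v.
have TT : linear_subspace [set: V] by [].
have T0 : exists2 v, [set: V] v & iota v != 0.
  exists (e 0%N) => //; apply: iota_neq0; apply/eqP => e0.
  have [/(_ 0%N)[_ + _] _ _] := he.
  by rewrite e0 dot0l => /eqP; rewrite eq_sym oner_eq0.
have [s [u [s0 hu hs]]] := rayleigh_maximizer ha hcompact TT closedT T0.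
apply: le_trans (hs v Logic.I) _; rewrite ler_wpM2r ?dot_ge0//.
have [i hi] : exists i, lam i = s^-1.
  apply: contrapT => ni; apply: (eigenpair_not_orthogonal he hu) => i hi.
  by case: ni; exists i.
by rewrite -[s]invrK -hi lef_pV2 ?posrE// ?(lt_le_trans lam0)// lam_mono.
Qed.

Section Discrete.
Context {A Vh : set V} {n : nat} {mu : 'I_n -> R} {e : 'I_n -> V}.
Hypotheses (hA : linear_subspace A) (Vh_fin : finite_dim Vh) (AVh : A `<=` Vh).
Hypothesis he : eigensystem a b iota A mu e.

Lemma eigensystem_orthonormal : orthonormal_family a e.
Proof.
have [ep eo _] := he; move=> i j; have [<-|/eqP/eo//] := eqVneq i j.
by have [_] := ep i.
Qed.

Lemma eigensystem_orthogonal i j : B (e i) (e j) = (i == j)%:R * (mu i)^-1.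
Proof.
have [ep _ _] := he; have [mu0 _] := eigenpair_gt0 (ep i).
have [[_ _ h] [Aej _ _]] := (ep i, ep j).
by rewrite -eigensystem_orthonormal h// mulrAC mulfV ?mul1r// gt_eqF.
Qed.

(** The a-orthogonal complement in A of the listed eigenfunctions; it is
    shown to be zero. *)
Let S := [set x | A x /\ forall i, a x (e i) = 0].

Let S_subspace : linear_subspace S.
Proof.
split=> [|c u v [Au eu] [Av ev]].
  by split=> [|i]; [case: hA|rewrite dot0l].
split=> [|i]; first by case: hA => _; apply.
by rewrite dotDl dotZl eu ev mulr0 addr0.
Qed.

Let S_closed : closed S.
Proof.
have [m [q [hq Sq qS]]] :=
  orthonormal_basis a S_subspace Vh_fin (fun x (Sx : S x) => AVh Sx.1).
suff -> : S = [set v | v = oproj a q v] by exact: orthonormal_span_closed.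
by apply/seteqP; split=> [v /qS//|v ->]; exact: subspace_oproj.
Qed.

(** A test function in A splits into a part in S and a combination of the
    e_i; both forms vanish between u and every e_i, as
    0 = a(e_i, u) = mu_i b(e_i, u). *)
Let S_eigenpair nu u : eigenpair a b iota S nu u -> eigenpair a b iota A nu u.
Proof.
move=> [[Au eu] u1 h]; split=> // v Av; have [ep _ _] := he.
have Aev : A (oproj a e v) by apply: subspace_oproj => // i; case: (ep i).
have Sw : S (v - oproj a e v).
  split=> [|i]; first exact: subspaceB.
  by rewrite dotBl (dot_oproj eigensystem_orthonormal) subrr.
have a0 : a u (oproj a e v) = 0.
  by rewrite dotC dot_suml big1// => i _; rewrite dotZl (dotC _ (e i)) eu mulr0.
have b0 : B u (oproj a e v) = 0.
  rewrite dotC linear_sum dot_suml big1// => i _.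
  rewrite linearZ dotZl; have [_ _ /(_ u Au)] := ep i.
  have [mu0 _] := eigenpair_gt0 (ep i).
  rewrite (dotC a (e i)) eu => /esym/eqP; rewrite mulf_eq0 gt_eqF//= => /eqP ->.
  by rewrite mulr0.
have := h _ Sw; rewrite (linearB iota) !dotBr a0 b0.
by rewrite !subr0.
Qed.

Lemma eigensystem_complete v : A v -> v = oproj a e v.
Proof.
move=> Av; have [ep _ _] := he; have hon := eigensystem_orthonormal.
apply/eqP; rewrite -subr_eq0; apply/negPn/negP => w0.
have S_neq0 : exists2 v, S v & iota v != 0.
  exists (v - oproj a e v); last exact: iota_neq0.
  split=> [|i]; last by rewrite dotBl dot_oproj// subrr.
  by apply: subspaceB => //; apply: subspace_oproj => // i; case: (ep i).
have [s [u [_ hu _]]] := rayleigh_maximizer ha hcompact S_subspace S_closed S_neq0.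
apply: (eigenpair_not_orthogonal he (S_eigenpair hu)) => i _.
by have [[_ eu] _ _] := hu; rewrite dotC.
Qed.

End Discrete.
End Eigen.

(** * Approximation of the solution operator by the coarse space *)

Section Estimates.
Context {R : realType} {V W : completeNormedModType R}.
Context {a : {dot V for idfun}} {b : {dot W for idfun}} {iota : {linear V -> W}}.
Context {lam1 : R}.
Hypothesis lam1_gt0 : 0 < lam1.
Local Notation B u v := (b (iota u) (iota v)).
Hypothesis poincare : forall v, B v v <= lam1^-1 * a v v.

Section Eta.
Context {T : W -> V} {VH : set V}.
Hypotheses (hT : solution_operator a b iota T) (hVH : linear_subspace VH).
Local Notation eta := (eta_a a b T VH).

Lemma solution_operatorZ c f : T (c *: f) = c *: T f.
Proof.
apply/eqP; rewrite -subr_eq0; apply/eqP/(@dot_eq0 _ _ a).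
by rewrite {1}dotBl dotZl !hT dotZl subrr.
Qed.

(** Combines a(Tf, Tf) = b(f, Tf) with Cauchy-Schwarz for b and the Poincare
    inequality.  It makes the supremum in eta_a one of a bounded set. *)
Lemma solution_operator_bounded f : a (T f) (T f) <= lam1^-1 * b f f.
Proof.
set x := a (T f) (T f); have x0 : 0 <= x by exact: dot_ge0.
have : x ^+ 2 <= b f f * (lam1^-1 * x).
  apply: le_trans (_ : _ <= b f f * B (T f) (T f)) _; last first.
    by rewrite ler_wpM2l ?dot_ge0.
  rewrite /x hT -!sqr_enorm -exprMn -[leLHS]real_normK ?num_real//.
  by rewrite ler_sqr ?nnegrE ?mulr_ge0 ?enorm_ge0// dot_CauchySchwarz.
have [->|xn0] := eqVneq x 0; first by rewrite mulr_ge0 ?dot_ge0// invr_ge0 ltW.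
by rewrite mulrA expr2 ler_pM2r ?lt_def ?xn0// mulrC.
Qed.

(** The defining property of eta_a, freed from the normalization of f and
    stated through lower bounds because the infimum over VH need not be
    attained. *)
Lemma eta_a_le f (K : R) :
  (forall v, VH v -> K <= enorm a (T f - v)) -> K <= eta * enorm b f.
Proof.
move=> hK; have VH0 : VH 0 by case: hVH.
have [f0|f0] := eqVneq f 0.
  have := hK 0 VH0; rewrite f0 -[X in T X](scale0r 0) solution_operatorZ scale0r.
  by rewrite subr0 !enorm0 mulr0.
have ef : 0 < enorm b f.
  by rewrite lt_def enorm_ge0 andbT; apply: contra_neq f0 => /enorm_eq0.
pose D g := [set enorm a (T g - v) | v in VH].
have D0 g : D g !=set0 by exists (enorm a (T g - 0)), 0.
have D_lb g : lbound (D g) 0 by move=> _ [v _ <-]; exact: enorm_ge0.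
rewrite -ler_pdivrMr//.
apply: le_trans (_ : _ <= inf (D ((enorm b f)^-1 *: f))) _.
  apply: lb_le_inf => // _ [v VHv <-].
  rewrite solution_operatorZ -[v](scalerK (lt0r_neq0 ef)) -scalerBr enormZ.
  rewrite gtr0_norm ?invr_gt0// mulrC ler_pM2l ?invr_gt0//.
  by apply: hK; exact: subspaceZ.
apply: ub_le_sup; last first.
  exists ((enorm b f)^-1 *: f) => //=.
  by rewrite /enorm dot_normalize// sqrtr1.
exists (Num.sqrt lam1^-1) => _ [g /= g1 <-].
apply: le_trans (_ : _ <= enorm a (T g - 0)) _.
  by apply: ge_inf; [exists 0; exact: D_lb|exists 0].
rewrite subr0; apply: enorm_le; first exact: sqrtr_ge0.
rewrite sqr_sqrtr ?invr_ge0 ?(ltW lam1_gt0)//.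
apply: le_trans (solution_operator_bounded g) _.
by rewrite -sqr_enorm g1 expr1n mulr1.
Qed.

(** When W is zero, eta_a is the supremum of the empty set, which is 0. *)
Lemma eta_a_ge0 : 0 <= eta.
Proof.
have [[f f1]|nf] := pselect (exists f, enorm b f = 1).
  have : 0 <= eta * enorm b f by apply: eta_a_le => v _; exact: enorm_ge0.
  by rewrite f1 mulr1.
rewrite /eta_a (_ : [set f | _] = set0) ?image_set0 ?sup0//.
by apply/seteqP; split=> // f f1; apply: nf; exists f.
Qed.

(** Duality: ||g||_b^2 = a(Tg, g) = a(Tg - v, g) for every v in VH, so the
    distance from Tg to VH bounds ||g||_b^2 / ||g||_a. *)
Lemma aubin_nitsche g :
  (forall v, VH v -> a v g = 0) -> enorm b (iota g) <= eta * enorm a g.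
Proof.
move=> g_perp; have [g0|g0] := eqVneq (enorm b (iota g)) 0.
  by rewrite g0 mulr_ge0 ?eta_a_ge0 ?enorm_ge0.
have bg : 0 < enorm b (iota g) by rewrite lt_def g0 enorm_ge0.
have [ag|ag] := eqVneq (enorm a g) 0.
  by move: bg; rewrite (enorm_eq0 ag) linear0 (enorm0 b) ltxx.
have ag0 : 0 < enorm a g by rewrite lt_def ag enorm_ge0.
rewrite -(ler_pM2r bg) mulrAC -ler_pdivrMr//.
apply: eta_a_le => v VHv; rewrite ler_pdivrMr//.
rewrite -expr2 sqr_enorm -hT -[a _ _]subr0 -(g_perp v VHv) -dotBl.
exact: le_trans (ler_norm _) (dot_CauchySchwarz _ _ _).
Qed.

End Eta.

(** * Spectral projection error on one augmented space *)

Section OneStep.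
Context {A Vh : set V} {n : nat} {mu : 'I_n -> R} {e : 'I_n -> V}.
Hypotheses (hA : linear_subspace A) (AVh : A `<=` Vh).
Hypothesis he : eigensystem a b iota A mu e.
Context {lbar : R} {ubar : V} {i0 : 'I_n} {delta : R}.
Hypothesis hbar : eigenpair a b iota Vh lbar ubar.
Hypothesis delta_gt0 : 0 < delta.
Hypothesis hgap : forall j, j != i0 -> delta <= `|(mu j)^-1 - lbar^-1|.

Local Notation r := (ubar - oproj a e ubar).
Local Notation c := (a ubar (e i0)).
Local Notation D := (oproj a e ubar - c *: e i0).

Let ep : forall i, eigenpair a b iota A (mu i) (e i).
Proof. by case: he. Qed.
Let e_orthonormal : orthonormal_family a e := eigensystem_orthonormal he.
Let e_orthogonal := eigensystem_orthogonal he.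
Let mu_gt0 j : 0 < mu j. Proof. by case: (eigenpair_gt0 (ep j)). Qed.

(** Bessel's inequality in b for the b-orthonormal family sqrt(mu_j) e_j. *)
Lemma bessel_eigenfunctions w :
  \sum_j mu j * b w (iota (e j)) ^+ 2 <= b w w.
Proof.
have hon : orthonormal_family b (fun j => Num.sqrt (mu j) *: iota (e j)).
  move=> i j; rewrite dotZl dotZr e_orthogonal.
  have [<-|_] := eqVneq i j; last by rewrite mul0r !mulr0.
  by rewrite mul1r mulrA -expr2 sqr_sqrtr ?mulfV ?gt_eqF// ltW.
apply: le_trans (bessel hon w).
apply: ler_sum => j _; rewrite dotZr exprMn sqr_sqrtr//.
by rewrite ltW.
Qed.

(** Test the problem on A with the projection of ubar, and the problem on Vh
    with e_j: a(ubar, e_j) is mu_j b(proj ubar, e_j) and lbar b(ubar, e_j). *)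
Lemma eigenvalue_defect j :
  ((mu j)^-1 - lbar^-1) * a ubar (e j) = - B r (e j).
Proof.
have [Aej _ hj] := ep j; have [lbar0 _] := eigenpair_gt0 hbar.
have [_ _ /(_ _ (AVh Aej)) hu] := hbar.
have Aproj : A (oproj a e ubar) by apply: subspace_oproj => // i; case: (ep i).
have := hj _ Aproj; rewrite (dotC a) (dot_oproj e_orthonormal) => hp.
rewrite (linearB iota) dotBl mulrBl {1}hp hu !mulKf ?gt_eqF//.
by rewrite (dotC b (iota (e j))) opprB.
Qed.

(** ||D||_a^2 is the sum over j <> i0 of a(ubar, e_j)^2, and each term is at most
    b(r, e_j)^2 / delta^2 by eigenvalue_defect.  As lam1 <= mu_j, weighting
    the terms by mu_j / lam1 brings the sum under Bessel's inequality. *)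
Lemma gap_estimate : a D D <= (lam1 * delta ^+ 2)^-1 * B r r.
Proof.
have -> : D = \sum_(j | j != i0) a ubar (e j) *: e j.
  by rewrite /oproj (bigD1 i0)//= addrAC subrr add0r.
rewrite (dot_sum_orthogonal (d := fun=> 1)) => [|i j]; last first.
  by rewrite mulr1 e_orthonormal.
have ld0 : 0 <= (lam1 * delta ^+ 2)^-1.
  by rewrite invr_ge0 mulr_ge0 ?sqr_ge0// ltW.
apply: le_trans (ler_wpM2l ld0 (bessel_eigenfunctions (iota r))).
rewrite mulr_sumr [leRHS](bigD1 i0)//= -[leLHS]add0r.
apply: lerD => [|]; last apply: ler_sum => j ji.
  by rewrite mulr_ge0// mulr_ge0 ?sqr_ge0// ltW.
rewrite mulr1 -[X in _ * (_ * X)]sqrrN -eigenvalue_defect.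
have lam1_mu : lam1 <= mu j.
  have [_ ej1 _] := ep j; have := poincare (e j).
  by rewrite e_orthogonal eqxx mul1r ej1 mulr1 lef_pV2 ?posrE.
have gap2 : delta ^+ 2 <= ((mu j)^-1 - lbar^-1) ^+ 2.
  rewrite -[leRHS]real_normK ?num_real// ler_sqr ?nnegrE ?normr_ge0//.
    exact: hgap.
  exact: ltW.
set g := _ - _ in gap2 *.
have -> : (lam1 * delta ^+ 2)^-1 * (mu j * (g * a ubar (e j)) ^+ 2)
    = (lam1 * delta ^+ 2)^-1 * (mu j * g ^+ 2) * a ubar (e j) ^+ 2.
  by rewrite exprMn !mulrA.
apply: ler_peMl; first exact: sqr_ge0.
rewrite ler_pdivlMl ?mul1r ?mulr1; last by rewrite mulr_gt0// exprn_gt0.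
by rewrite ler_pM ?sqr_ge0// ltW.
Qed.

Context {T : W -> V} {VH : set V}.
Hypotheses (hT : solution_operator a b iota T) (hVH : linear_subspace VH).
Hypothesis VHA : VH `<=` A.
Hypothesis e_complete : forall v, A v -> v = oproj a e v.
Local Notation eta := (eta_a a b T VH).

Let ritz_orthogonal v : A v -> a r v = 0.
Proof. by move=> /e_complete ->; rewrite oproj_orthogonal. Qed.

Let ritz_b : enorm b (iota r) <= eta * enorm a r.
Proof.
by apply: aubin_nitsche => // v /VHA Av; rewrite dotC ritz_orthogonal.
Qed.

(** Pythagoras for r + D, with D bounded by gap_estimate and then r by
    Aubin-Nitsche. *)
Lemma eigenfunction_estimate_a :
  enorm a (ubar - c *: e i0)
    <= Num.sqrt (1 + eta ^+ 2 / (lam1 * delta ^+ 2)) * enorm a r.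
Proof.
have ld0 : 0 < (lam1 * delta ^+ 2)^-1 by rewrite invr_gt0 mulr_gt0 ?exprn_gt0.
have q0 : 0 <= 1 + eta ^+ 2 / (lam1 * delta ^+ 2).
  by rewrite addr_ge0// mulr_ge0 ?sqr_ge0// ltW.
apply: enorm_le; first by rewrite mulr_ge0 ?sqrtr_ge0 ?enorm_ge0.
have -> : ubar - c *: e i0 = r + D by rewrite addrA subrK.
rewrite exprMn sqr_sqrtr//.
rewrite hnormDd; last first.
  apply: ritz_orthogonal; apply: subspaceB => //.
    by apply: subspace_oproj => // i; case: (ep i).
  by apply: subspaceZ => //; case: (ep i0).
rewrite mulrDl mul1r sqr_enorm lerD2l.
apply: le_trans gap_estimate _.
rewrite mulrAC mulrC ler_pM2r// -!sqr_enorm -exprMn.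
by rewrite ler_sqr ?nnegrE ?mulr_ge0 ?enorm_ge0// (eta_a_ge0 hT hVH).
Qed.

(** Triangle inequality for r + D; the Poincare inequality turns the energy
    bound of gap_estimate into ||D||_b <= ||r||_b / (lam1 delta). *)
Lemma eigenfunction_estimate_b :
  enorm b (iota (ubar - c *: e i0))
    <= (1 + (lam1 * delta)^-1) * eta * enorm a (ubar - c *: e i0).
Proof.
have ld0 : 0 < lam1 * delta by rewrite mulr_gt0.
have Dr : enorm b (iota D) <= (lam1 * delta)^-1 * enorm b (iota r).
  apply: enorm_le; first by rewrite mulr_ge0 ?enorm_ge0// invr_ge0 ltW.
  apply: le_trans (poincare _) _.
  rewrite exprMn sqr_enorm.
  apply: le_trans (ler_wpM2l _ gap_estimate) _; first by rewrite invr_ge0 ltW.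
  by rewrite mulrA -invfM exprVn exprMn mulrA -expr2.
have -> : iota (ubar - c *: e i0) = iota r + iota D.
  by rewrite -linearD addrA subrK.
apply: le_trans (enormD _ _ _) _.
apply: le_trans (lerD (lexx _) Dr) _.
rewrite -[X in X + _]mul1r -mulrDl -mulrA ler_wpM2l//.
  by rewrite addr_ge0// invr_ge0 ltW.
apply: le_trans ritz_b _; rewrite ler_wpM2l ?(eta_a_ge0 hT hVH)//.
have [Ae _ _] := ep i0.
by rewrite [c *: _]e_complete ?(oproj_min e_orthonormal)//; exact: subspaceZ.
Qed.
End OneStep.

(** * The correction step *)

Section Correction.
Context {VH Vh : set V} {T : W -> V} {lbar m k : R} {ubar u uhat : V}.
Hypotheses (hT : solution_operator a b iota T) (hVH : linear_subspace VH).
Hypotheses (hVh : linear_subspace Vh) (VH_Vh : VH `<=` Vh).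
Hypothesis hbar : eigenpair a b iota Vh lbar ubar.
Hypotheses (m_gt0 : 0 < m) (Vh_uhat : Vh uhat).
Hypothesis huhat : forall v, Vh v -> a uhat v = m * B u v.

(** The vector w = ubar - (lbar k / m) uhat satisfies
    a(w, x) = lbar b(ubar - k u, x) on Vh: it is the a-projection onto Vh of
    lbar T (ubar - k u).  Hence it is at least as close to VH as that function
    is, and eta_a measures the latter distance. *)
Lemma correction_estimate (K : R) :
  (forall v, VH v -> K <= enorm a (ubar - ((lbar * k / m) *: uhat + v))) ->
  K <= lbar * (eta_a a b T VH * enorm b (iota (ubar - k *: u))).
Proof.
have [lbar0 _] := eigenpair_gt0 hbar; have [Vh_ubar _ hu] := hbar.
move=> hK; rewrite -ler_pdivrMl//; apply: eta_a_le => // v VHv.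
rewrite ler_pdivrMl//.
(* T f is compared with v, hence w = proj (lbar T f) with lbar v. *)
apply: le_trans (hK (lbar *: v) (subspaceZ hVH _ VHv)) _.
rewrite opprD addrA; set w := ubar - (lbar * _ / m) *: uhat.
have w_weak x : Vh x -> a w x = a (lbar *: T (iota (ubar - k *: u))) x.
  move=> Vhx; rewrite dotBl !dotZl hu// huhat// hT (linearB iota) dotBl.
  by rewrite (linearZ_LR iota) dotZl; field; rewrite gt_eqF.
set F := T _ in w_weak *.
have perp : a (w - lbar *: v) (lbar *: F - w) = 0.
  rewrite dotC dotBl w_weak ?subrr//.
  apply: subspaceB => //; last exact/subspaceZ/VH_Vh.
  by apply: subspaceB => //; exact: subspaceZ.
rewrite -[X in X * _](gtr0_norm lbar0) -enormZ scalerBr.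
apply: enorm_le; first exact: enorm_ge0.
have -> : lbar *: F - lbar *: v = (w - lbar *: v) + (lbar *: F - w).
  by rewrite addrAC subrKC.
rewrite sqr_enorm [leRHS]hnormDd//.
by rewrite lerDl dot_ge0.
Qed.
End Correction.
End Estimates.

(** * The augmented subspace method *)

Section AugmentedSpace.
Context {R : realType} {V : completeNormedModType R} {VH : set V} {uhat : V}.
Hypothesis hVH : linear_subspace VH.
Local Notation S := (augmented_space VH uhat).

Lemma augmented_subspace : linear_subspace S.
Proof.
have hL := lspan_subspace [set uhat].
split=> [|c _ _ [v1 v1H [w1 w1L <-]] [v2 v2H [w2 w2L <-]]].
  by exists 0; [case: hVH|exists 0; [case: hL|rewrite addr0]].
exists (c *: v1 + v2); first by case: hVH => _; apply.
exists (c *: w1 + w2); first by case: hL => _; apply.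
by rewrite scalerDr addrACA.
Qed.

Lemma mem_augmented c v : VH v -> S (c *: uhat + v).
Proof.
by exists v => //; exists (c *: uhat); [exact: mem_lspan1|rewrite addrC].
Qed.

Lemma augmented_sub Vh :
  linear_subspace Vh -> VH `<=` Vh -> Vh uhat -> S `<=` Vh.
Proof.
move=> hVh VH_Vh Vhu _ [v VHv [w /lspan1[c ->] <-]].
by apply: subspaceD => //; [exact: VH_Vh|exact: subspaceZ].
Qed.

End AugmentedSpace.

Lemma spectral_projectorE (R : realType) (V : completeNormedModType R)
    (a : {dot V for idfun}) u (E : V -> V) w :
  a u u = 1 -> spectral_projector a u E -> E w = a w u *: u.
Proof.
move=> u1 /(_ w)[/lspan1[c ->]]; by rewrite dotZl u1 mulr1 => ->.
Qed.

Theorem theorem3p2 (R : realType) (V W : completeNormedModType R)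
  (a : {dot V for idfun}) (b : {dot W for idfun})
  (ha : forall v : V, `|v| = enorm a v)
  (hb : forall w : W, `|w| = enorm b w)
  (iota : {linear V -> W}) (iota_inj : injective iota)
  (hcompact : relatively_compact_norm a b iota)
  (lam : nat -> R) (hlam : eigenvalue_sequence a b iota lam)
  (Vh VH : set V) (Vh_subspace : linear_subspace Vh) (Vh_fin : finite_dim Vh)
  (VH_subspace : linear_subspace VH) (VH_Vh : VH `<=` Vh)
  (T : W -> V) (hT : solution_operator a b iota T)
  (lbar : R) (ubar : V) (hbar : eigenpair a b iota Vh lbar ubar)
  (uhat : nat -> V) (N : nat -> nat) (mu : forall l, 'I_(N l) -> R)
  (e : forall l, 'I_(N l) -> V) (i : forall l, 'I_(N l))
  (hmethod : augmented_subspace_method a b iota Vh VH uhat mu e i)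
  (hclosest : forall l : nat, (1 <= l)%N -> forall j : 'I_(N l),
    `|(mu l (i l))^-1 - lbar^-1| <= `|(mu l j)^-1 - lbar^-1|)
  (delta : R) (delta_gt0 : 0 < delta)
  (hgap : forall l : nat, (1 <= l)%N -> forall j : 'I_(N l), j != i l ->
    delta <= `|(mu l j)^-1 - lbar^-1|)
  (E : nat -> V -> V)
  (hE : forall l : nat, (1 <= l)%N -> spectral_projector a (e l (i l)) (E l)) :
  forall l : nat, (1 <= l)%N ->
    enorm a (ubar - E l.+1 ubar) <=
      lbar
      * Num.sqrt (1 + eta_a a b T VH ^+ 2 / (lam 0%N * delta ^+ 2))
      * (1 + (lam 0%N * delta)^-1) * eta_a a b T VH ^+ 2
      * enorm a (ubar - E l ubar)
    /\
    enorm b (iota (ubar - E l.+1 ubar)) <=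
      (1 + (lam 0%N * delta)^-1) * eta_a a b T VH
      * enorm a (ubar - E l.+1 ubar).
Proof.
move=> l l1; have [lam0 _ _ _] := hlam.
have P := rayleigh_le_first_eigenvalue ha hcompact iota_inj hlam.
have [uhat1 method] := hmethod.
have Vh_uhat m : (1 <= m)%N -> Vh (uhat m).
  by case: m => [//|[//|m _]]; have [] := method m.+1 isT.
have [es _ _ huhat] := method l l1; have [es' _ _ _] := method l.+1 isT.
have hS m := augmented_subspace (uhat := uhat m) VH_subspace.
have S_Vh m (m1 : (1 <= m)%N) := augmented_sub Vh_subspace VH_Vh (Vh_uhat m m1).
have VH_S m : VH `<=` augmented_space VH (uhat m).
  move=> v VHv; rewrite -[v]add0r -[X in X + _](scale0r (uhat m)).
  exact: mem_augmented.
have est m (m1 : (1 <= m)%N) :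
    eigensystem a b iota (augmented_space VH (uhat m)) (mu m) (e m) ->
  enorm a (ubar - E m ubar) <=
    Num.sqrt (1 + eta_a a b T VH ^+ 2 / (lam 0%N * delta ^+ 2))
    * enorm a (ubar - oproj a (e m) ubar) /\
  enorm b (iota (ubar - E m ubar)) <=
    (1 + (lam 0%N * delta)^-1) * eta_a a b T VH * enorm a (ubar - E m ubar).
  move=> esm; have [ep _ _] := esm; have [_ e1 _] := ep (i m).
  rewrite (spectral_projectorE ubar e1 (hE m m1)).
  have hcomplete := eigensystem_complete ha hcompact iota_inj (hS m) Vh_fin
    (S_Vh m m1) esm.
  split.
    exact: (eigenfunction_estimate_a lam0 P (hS m) (S_Vh m m1) esm hbar
      delta_gt0 (hgap m m1) hT VH_subspace (@VH_S m) hcomplete).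
  exact: (eigenfunction_estimate_b lam0 P (hS m) (S_Vh m m1) esm hbar
    delta_gt0 (hgap m m1) hT VH_subspace (@VH_S m) hcomplete).
have [_ estb] := est l l1 es; have [esta' estb'] := est l.+1 isT es'.
split=> //; apply: le_trans esta' _.
have [ep _ _] := es; have [mu0 _] := eigenpair_gt0 (ep (i l)).
have [_ e1 _] := ep (i l); have [lbar0 _] := eigenpair_gt0 hbar.
have hcor : enorm a (ubar - oproj a (e l.+1) ubar) <=
    lbar * (eta_a a b T VH * enorm b (iota (ubar - E l ubar))).
  rewrite (spectral_projectorE ubar e1 (hE l l1)).
  apply: (correction_estimate lam0 P hT VH_subspace Vh_subspace VH_Vh hbar mu0
    (Vh_uhat l.+1 isT) huhat) => v VHv.
  have hcomplete := eigensystem_complete ha hcompact iota_inj (hS l.+1) Vh_fin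
    (S_Vh l.+1 isT) es'.
  rewrite [_ + v]hcomplete; last exact: mem_augmented.
  exact: (oproj_min (eigensystem_orthonormal es')).
have eta0 := eta_a_ge0 lam0 P hT VH_subspace.
apply: le_trans (ler_wpM2l (sqrtr_ge0 _) hcor) _.
have -> : forall s k h d : R,
    lbar * s * k * h ^+ 2 * d = s * (lbar * (h * (k * h * d))).
  by move=> *; ring.
by rewrite !ler_wpM2l ?sqrtr_ge0// ltW.
Qed.
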